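(* Let $p(z)=z^n+a_{n-1}z^{n-1}+a_{n-2}z^{n-2}+\cdots+a_1z+a_0$ be a monic polynomial of degree $n$ with coefficients $a_0,\dots,a_{n-1}\in\mathbb{C}$, let $C(p)$ be its Frobenius companion matrix, and let $\lambda$ be a zero of $p(z)$. Then $$|\lambda|\le w(C(p))\le\frac12\left[|a_{n-1}|+\cos\frac{\pi}{n}+\sqrt{|a_{n-1}|^2+\alpha}+\sqrt{\cos^2\frac{\pi}{n}+1}\right],$$ where $\alpha=\sqrt{\sum_{r=0}^{n-2}|a_r|^2}$.
   Context: The Frobenius companion matrix of $p$ is the $n\times n$ matrix $$C(p)=\begin{pmatrix}-a_{n-1}&-a_{n-2}&\cdots&-a_1&-a_0\\1&0&\cdots&0&0\\0&1&\cdots&0&0\\\vdots&\vdots&&\vdots&\vdots\\0&0&\cdots&1&0\end{pmatrix},$$ regarded as a bounded linear operator on $\mathbb{C}^n$ with the usual inner product. The numerical radius of an operator $T$ on $\mathbb{C}^n$ is $w(T)=\sup\{|\langle Tx,x\rangle| : x\in\mathbb{C}^n,\ \|x\|=1\}$.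
   Formalization: The third term is proved as sqrt(|a_{n-1}|^2 + alpha^2) instead of sqrt(|a_{n-1}|^2 + alpha); the printed bound is false, e.g. for p = z^2 - 100 with zero 10 it gives 5.5. *)

(* Defs.v *)
From mathcomp Require Export all_boot all_order all_algebra.
From mathcomp.real_closed Require Export complex.
From mathcomp Require Export all_classical all_reals all_analysis.

Set Implicit Arguments.
Unset Strict Implicit.
Unset Printing Implicit Defensive.
Import Order.TTheory GRing.Theory Num.Theory.
Export Normc.

Local Open Scope classical_set_scope.
Local Open Scope ring_scope.

(* [normc : R[i] -> R] is used for the modulus, since [`|z|] has type [R[i]]. *)

(* Linear in the first argument, conjugate-linear in the second. *)
Definition inner (R : realType) (n : nat) (x y : 'cV[R[i]]_n) : R[i] :=
  \sum_(i < n) x i 0 * conjc (y i 0).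

Definition l2norm (R : realType) (n : nat) (x : 'cV[R[i]]_n) : R :=
  Num.sqrt (complex.Re (inner x x)).

Definition numerical_radius (R : realType) (n : nat) (T : 'M[R[i]]_n) : R :=
  sup [set normc (inner (T *m x) x) | x in [set x : 'cV[R[i]]_n | l2norm x = 1]].

(* Top row [-a_{n-1}, ..., -a_0], ones on the subdiagonal; this differs from
   [mxpoly.companionmx], which has the coefficients in the last row and ones on
   the superdiagonal. Note that [rev_ord j] is [n - 1 - j]. *)
Definition frobenius_companion (R : realType) (n : nat) (p : {poly R[i]}) :
    'M[R[i]]_n :=
  \matrix_(i < n, j < n)
    if i == 0 :> nat then - p`_(rev_ord j) else (i == j.+1 :> nat)%:R.

(* Main.v *)
Require Import Defs.
From mathcomp Require Import ring lra.

(** Write [C] for the companion matrix of size [m + 1] and [x] for a unit vector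
    with moduli [r_0, ..., r_m].

    Lower bound: the vector [(lambda^m, ..., lambda, 1)] is an eigenvector of [C]
    for the zero [lambda], the top row of the eigenvalue equation being
    [p(lambda) = 0]. Evaluating the form [<C x, x>] at its normalisation gives
    [|lambda| <= w(C)].

    Upper bound: [<C x, x>] splits into the contribution of the top row, at most
    [(sum_j |a_{m-j}| r_j) r_0], and that of the subdiagonal, at most
    [sum_i r_i r_{i+1}]. With [t = r_0] and [rho = (r_1^2 + ... + r_m^2)^(1/2)],
    both are dominated by a quadratic form in two variables,
    [A t^2 + B t rho], whose largest eigenvalue is [(A + (A^2 + B^2)^(1/2)) / 2]
    ([bordered_form_le]).
    - For the top row, Cauchy-Schwarz gives [A = |a_m|] and [B = alpha]
      ([row_form_le]).
    - For the subdiagonal, the first product satisfies [r_0 r_1 <= t rho], and the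
      remaining ones form the quadratic form of a shift on [m] coordinates, whose
      numerical radius is [cos (pi / (m + 1))] ([path_form_le]); so the sum is at most
      [c rho^2 + t rho] ([shift_form_le]).
    Adding the two maxima yields the bound. Keeping the first product apart from
    the others is what produces the cosine of [pi / n] instead of the cosine of
    [pi / (n + 1)] attached to the whole shift. *)

Set Implicit Arguments.
Unset Strict Implicit.
Unset Printing Implicit Defensive.
Import Order.TTheory GRing.Theory Num.Theory.
Local Open Scope classical_set_scope.
Local Open Scope ring_scope.

(** * Real quadratic forms *)

Lemma cauchy_schwarz2 (R : rcfType) (x1 x2 y1 y2 : R) :
  x1 * y1 + x2 * y2 <=
    Num.sqrt (x1 ^+ 2 + x2 ^+ 2) * Num.sqrt (y1 ^+ 2 + y2 ^+ 2).
Proof.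
apply: (le_trans (ler_norm _)); rewrite -sqrtrM ?addr_ge0 ?sqr_ge0 // -sqrtr_sqr.
rewrite ler_wsqrtr // -subr_ge0.
(* Lagrange's identity *)
by rewrite (_ : _ - _ = (x1 * y2 - x2 * y1) ^+ 2) ?sqr_ge0 //; ring.
Qed.

Lemma cauchy_schwarz_sum (R : rcfType) (I : Type) (s : seq I) (a b : I -> R) :
  \sum_(i <- s) a i * b i <=
    Num.sqrt (\sum_(i <- s) a i ^+ 2) * Num.sqrt (\sum_(i <- s) b i ^+ 2).
Proof.
elim: s => [|i s IH]; first by rewrite !big_nil sqrtr0 mul0r.
have sum_sqr_ge0 (f : I -> R) : 0 <= \sum_(j <- s) f j ^+ 2.
  by apply: sumr_ge0 => j _; exact: sqr_ge0.
rewrite !big_cons; apply: (le_trans (lerD (lexx _) IH)).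
have := cauchy_schwarz2 (a i) (Num.sqrt (\sum_(j <- s) a j ^+ 2))
  (b i) (Num.sqrt (\sum_(j <- s) b j ^+ 2)).
by rewrite !sqr_sqrtr.
Qed.

(** The symmetric matrix with rows [(A, B/2)] and [(B/2, 0)] has largest eigenvalue
    [(A + (A^2 + B^2)^(1/2)) / 2]. Subtracting its half trace leaves the pairing of
    [(A, B)] with [(t^2 - r^2, 2 t r)], a vector of length [t^2 + r^2], and
    Cauchy-Schwarz applies. *)
Lemma bordered_form_le (R : rcfType) (A B t r : R) :
  A * t ^+ 2 + B * (t * r) <=
    2^-1 * (A + Num.sqrt (A ^+ 2 + B ^+ 2)) * (t ^+ 2 + r ^+ 2).
Proof.
have := cauchy_schwarz2 A B (t ^+ 2 - r ^+ 2) (2 * t * r).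
rewrite (_ : (t ^+ 2 - r ^+ 2) ^+ 2 + (2 * t * r) ^+ 2 =
             (t ^+ 2 + r ^+ 2) ^+ 2); last by ring.
rewrite sqrtr_sqr ger0_norm ?addr_ge0 ?sqr_ge0 //.
set h := Num.sqrt _; nra.
Qed.

(** The numerical radius of a rank-one operator with range the first axis: by
    Cauchy-Schwarz on the entries past the first it becomes a bordered form in
    [r 0] and the length of the rest. *)
Lemma row_form_le (R : rcfType) (m : nat) (u r : nat -> R) (r0_ge0 : 0 <= r 0) :
  (\sum_(j < m.+1) u j * r j) * r 0 <=
    2^-1 * (u 0 + Num.sqrt (u 0 ^+ 2 + \sum_(j < m) u j.+1 ^+ 2)) *
    \sum_(j < m.+1) r j ^+ 2.
Proof.
rewrite !big_ord_recl /=; under eq_bigr do rewrite /bump /= add1n.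
under [in leRHS]eq_bigr do rewrite /bump /= ?add1n.
have CS := cauchy_schwarz_sum (index_enum 'I_m)
  (fun j : 'I_m => u j.+1) (fun j : 'I_m => r j.+1).
have := bordered_form_le (u 0) (Num.sqrt (\sum_(j < m) u j.+1 ^+ 2)) (r 0)
  (Num.sqrt (\sum_(j < m) r j.+1 ^+ 2)).
rewrite !sqr_sqrtr; last 2 first.
- by apply: sumr_ge0 => j _; exact: sqr_ge0.
- by apply: sumr_ge0 => j _; exact: sqr_ge0.
apply: le_trans.
have := ler_wpM2r r0_ge0 CS; lra.
Qed.

(** The sines [s_k = sin (k theta)], [theta = pi / (m + 2)], are the Perron
    eigenvector of the path on [m + 1] vertices:
    [s_{k-1} + s_{k+1} = 2 cos(theta) s_k], positive for [0 < k < m + 2] and zero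
    at both ends. The arithmetic-geometric inequality weighted by the ratios of
    consecutive [s_k] therefore charges exactly [cos theta] to every [r_i^2]. *)
Lemma path_form_le (R : realType) (m : nat) (r : nat -> R) :
  \sum_(i < m) r i * r i.+1 <=
    cos (pi / m.+2%:R) * \sum_(i < m.+1) r i ^+ 2.
Proof.
set th := pi / m.+2%:R; pose s (k : nat) := sin (k%:R * th).
have s_gt0 k : (k < m.+1)%N -> 0 < s k.+1.
  move=> km; apply: sin_gt0_pi; rewrite /th mulr_gt0 ?divr_gt0 ?pi_gt0 //=.
  by rewrite mulrCA gtr_pMr ?pi_gt0 // ltr_pdivrMr // mul1r ltr_nat.
have s_rec k : s k + s k.+2 = 2 * cos th * s k.+1.
  rewrite /s (_ : k%:R * th = k.+1%:R * th - th) ?sinB;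
    last by rewrite -[in RHS]natr1; ring.
  rewrite (_ : k.+2%:R * th = k.+1%:R * th + th) ?sinD;
    last by rewrite -[in LHS]natr1; ring.
  ring.
have s_m2 : s m.+2 = 0 by rewrite /s /th mulrC divfK ?sinpi // pnatr_eq0.
(* The extra term is the share of [r k ^+ 2] kept for the next product; it vanishes
   at [k = m] because [s m.+2 = 0]. *)
suff H k : (k <= m)%N ->
    \sum_(i < k) r i * r i.+1 + 2^-1 * (s k.+2 / s k.+1) * r k ^+ 2 <=
      cos th * \sum_(i < k.+1) r i ^+ 2.
  by have := H m (leqnn m); rewrite s_m2 mul0r mulr0 mul0r addr0.
elim: k => [_|k IH km].
  rewrite big_ord0 big_ord1 add0r.
  have : s 1 != 0 by rewrite gt_eqF ?s_gt0.
  have : s 2 = 2 * cos th * s 1 by rewrite -s_rec /s mul0r sin0 add0r.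
  by move=> -> s1; rewrite mulfK // mulKf // pnatr_eq0.
rewrite big_ord_recr [in leRHS]big_ord_recr /=.
have a_gt0 := s_gt0 k (ltnW km); have b_gt0 := s_gt0 k.+1 km.
have amgm : r k * r k.+1 <=
    2^-1 * (s k.+2 / s k.+1) * r k ^+ 2 +
    2^-1 * (s k.+1 / s k.+2) * r k.+1 ^+ 2.
  rewrite -subr_ge0.
  rewrite (_ : _ - _ = 2^-1 / (s k.+1 * s k.+2) *
                       (s k.+2 * r k - s k.+1 * r k.+1) ^+ 2).
    by rewrite mulr_ge0 ?sqr_ge0 // divr_ge0 // ?mulr_ge0 ?ltW.
  by field; rewrite !gt_eqF.
have eq_cos : 2^-1 * (s k.+1 / s k.+2) + 2^-1 * (s k.+3 / s k.+2) = cos th.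
  rewrite -mulrDr -mulrDl s_rec mulfK ?gt_eqF // mulKf // pnatr_eq0.
have := IH (ltnW km).
have := congr1 ( *%R^~ (r k.+1 ^+ 2)) eq_cos; rewrite /=; lra.
Qed.

(** Only the products past the first are charged to the path on the last [m]
    coordinates; the first one is the off-diagonal term of a bordered form whose
    diagonal entry [c] is the bound for that path. *)
Lemma shift_form_le (R : realType) (m : nat) (r : nat -> R) (r0_ge0 : 0 <= r 0) :
  \sum_(i < m) r i * r i.+1 <=
    2^-1 * (cos (pi / m.+1%:R) + Num.sqrt (cos (pi / m.+1%:R) ^+ 2 + 1)) *
    \sum_(i < m.+1) r i ^+ 2.
Proof.
case: m => [|m]; set c := cos _.
  (* Here [c = cos pi] is negative, but [c + (c^2 + 1)^(1/2)] is not. *)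
  rewrite big_ord0 big_ord1 mulr_ge0 ?sqr_ge0 // mulr_ge0 //.
  have : `|c| <= Num.sqrt (c ^+ 2 + 1).
    by rewrite -sqrtr_sqr ler_wsqrtr // lerDl.
  by have := ler_norm (- c); rewrite normrN; lra.
rewrite big_ord_recl [in leRHS]big_ord_recl /=.
under eq_bigr do rewrite /bump /= add1n.
under [in leRHS]eq_bigr do rewrite /bump /= add1n.
set rho2 := \sum_(i < m.+1) r i.+1 ^+ 2.
have rho2_ge0 : 0 <= rho2 by apply: sumr_ge0 => j _; exact: sqr_ge0.
have r1_le : r 1 <= Num.sqrt rho2.
  apply: (le_trans (ler_norm _)); rewrite -sqrtr_sqr ler_wsqrtr //.
  by rewrite /rho2 big_ord_recl lerDl sumr_ge0 // => j _; exact: sqr_ge0.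
have path := path_form_le m (fun i => r i.+1).
have := bordered_form_le c 1 (Num.sqrt rho2) (r 0).
rewrite sqr_sqrtr // expr1n mul1r.
have := ler_wpM2l r0_ge0 r1_le.
rewrite -/c -/rho2 in path.
rewrite [rho2 + _]addrC; lra.
Qed.

(** * The inner product and the numerical radius *)

Lemma normc_conjc (R : rcfType) (z : R[i]) : normc (conjc z) = normc z.
Proof. by case: z => a b; rewrite /normc /= sqrrN. Qed.

Lemma normc_ge0 (R : rcfType) (z : R[i]) : 0 <= normc z.
Proof. by case: z => a b; exact: sqrtr_ge0. Qed.

Lemma normc_sum (R : rcfType) (I : Type) (s : seq I) (f : I -> R[i]) :
  normc (\sum_(i <- s) f i) <= \sum_(i <- s) normc (f i).
Proof.
elim/big_ind2: _ => // [|x1 x2 y1 y2 le1 le2]; first by rewrite normc0.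
by apply: (le_trans (le_normcD _ _)); exact: lerD.
Qed.

Lemma inner_self (R : realType) (n : nat) (x : 'cV[R[i]]_n) :
  inner x x = (\sum_(i < n) normc (x i 0) ^+ 2)%:C%C.
Proof.
rewrite /inner rmorph_sum /=; apply: eq_bigr => i _.
by rewrite -sqr_normc normc_def rmorphXn; case: (x i 0).
Qed.

Lemma l2normE (R : realType) (n : nat) (x : 'cV[R[i]]_n) :
  l2norm x = Num.sqrt (\sum_(i < n) normc (x i 0) ^+ 2).
Proof. by rewrite /l2norm inner_self. Qed.

Lemma innerZ (R : realType) (n : nat) (a b : R[i]) (x y : 'cV[R[i]]_n) :
  inner (a *: x) (b *: y) = a * conjc b * inner x y.
Proof.
rewrite /inner mulr_sumr; apply: eq_bigr => i _.
by rewrite !mxE rmorphM /=; ring.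
Qed.

(** The supremum of an unbounded set is a default value, hence the boundedness
    hypothesis; for the companion matrix it comes from the upper bound. *)
Lemma eigenvalue_le_numerical_radius (R : realType) (n : nat) (T : 'M[R[i]]_n)
    (v : 'cV[R[i]]_n) (lambda : R[i]) :
  v != 0 -> T *m v = lambda *: v ->
  has_ubound [set normc (inner (T *m x) x) | x in [set x | l2norm x = 1]] ->
  normc lambda <= numerical_radius T.
Proof.
move=> v0 Tv bnd; apply: ub_le_sup => //=.
have N_gt0 : 0 < \sum_(i < n) normc (v i 0) ^+ 2.
  rewrite lt_def sumr_ge0 ?andbT => [|i _]; last exact: sqr_ge0.
  apply: contra_neq v0 => /eqP; rewrite psumr_eq0 => [/allP z|i _];
    last exact: sqr_ge0.
  apply/colP => i; rewrite mxE; apply: eq0_normc; apply/eqP.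
  by have := z i (mem_index_enum _); rewrite sqrf_eq0.
set N := \sum_(i < n) _ in N_gt0.
pose u := ((Num.sqrt N)^-1)%:C%C *: v.
have uu : inner u u = 1.
  rewrite innerZ conjc_real inner_self -/N -!rmorphM /= -invfM -expr2.
  by rewrite sqr_sqrtr ?ltW // mulVf // gt_eqF.
exists u; first by rewrite /l2norm uu sqrtr1.
rewrite -scalemxAr Tv scalerA mulrC -scalerA -[X in inner _ X]scale1r innerZ.
by rewrite uu conjc1 !mulr1.
Qed.

(** * The companion matrix *)

Lemma companion_mulmx_row0 (R : realType) (m : nat) (p : {poly R[i]})
    (x : 'cV[R[i]]_m.+1) :
  (frobenius_companion m.+1 p *m x) ord0 0 =
    - \sum_(j < m.+1) p`_(rev_ord j) * x j 0.
Proof.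
by rewrite mxE -sumrN; apply: eq_bigr => j _; rewrite mxE /= mulNr.
Qed.

Lemma companion_mulmx_rowS (R : realType) (m : nat) (p : {poly R[i]})
    (x : 'cV[R[i]]_m.+1) (i : 'I_m) :
  (frobenius_companion m.+1 p *m x) (lift ord0 i) 0 =
    x (widen_ord (leqnSn m) i) 0.
Proof.
rewrite mxE (bigD1 (widen_ord (leqnSn m) i)) //= mxE /= eqxx mul1r.
rewrite big1 ?addr0 // => j ji; rewrite mxE /= eqSS.
suff -> : (i == j :> nat) = false by rewrite mul0r.
by apply: contraNF ji => /eqP ij; apply/eqP/val_inj.
Qed.

(** Rows below the top shift the powers of [lambda] and hold for every [lambda];
    the top row says [lambda^(m+1) = - sum_j a_j lambda^j]. *)
Lemma companion_eigenvector (R : realType) (m : nat) (p : {poly R[i]})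
    (lambda : R[i]) :
  p \is monic -> size p = m.+2 -> root p lambda ->
  let v : 'cV[R[i]]_m.+1 := \col_i lambda ^+ rev_ord i in
  frobenius_companion m.+1 p *m v = lambda *: v.
Proof.
move=> pmon psz /rootP proot v; apply/colP => i; rewrite [RHS]mxE.
case: (unliftP ord0 i) => [j|] ->.
  rewrite companion_mulmx_rowS !mxE -exprS; congr (_ ^+ _).
  by rewrite /= /bump /= add1n !subSS subnSK.
rewrite companion_mulmx_row0 mxE /= subn1 -exprS /=.
under eq_bigr do rewrite mxE.
have -> : \sum_(j < m.+1) p`_(rev_ord j) * lambda ^+ rev_ord j =
    \sum_(j < m.+1) p`_j * lambda ^+ j by rewrite [RHS](reindex_inj rev_ord_inj).
move: proot; rewrite horner_coef psz big_ord_recr /=.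
have -> : p`_m.+1 = 1 by have /monicP := pmon; rewrite /lead_coef psz.
by rewrite mul1r addrC => /eqP; rewrite addr_eq0 => /eqP.
Qed.

(** The triangle inequality reduces the form of the companion matrix to the row form
    and the shift form in the moduli of the coordinates. *)
Lemma companion_form_le (R : realType) (m : nat) (p : {poly R[i]})
    (x : 'cV[R[i]]_m.+1) :
  let c : R := cos (pi / m.+1%:R) in
  l2norm x = 1 ->
  normc (inner (frobenius_companion m.+1 p *m x) x) <=
    2^-1 * (normc p`_m + c
            + Num.sqrt (normc p`_m ^+ 2 + \sum_(r < m) normc p`_r ^+ 2)
            + Num.sqrt (c ^+ 2 + 1)).
Proof.
move=> c; rewrite l2normE => x1.
(* Moduli and coefficients are indexed by [nat], as the real forms are; [u] lists
   the top row from left to right. *)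
pose r k := normc (x (inord k) 0); pose u k := normc p`_(m - k).
have rE (j : 'I_m.+1) : normc (x j 0) = r j by rewrite /r inord_val.
have r0_ge0 : 0 <= r 0 by exact: normc_ge0.
have r1 : \sum_(j < m.+1) r j ^+ 2 = 1.
  rewrite -[RHS](expr1n _ 2) -x1 sqr_sqrtr;
    last by apply: sumr_ge0 => j _; exact: sqr_ge0.
  by apply: eq_bigr => j _; rewrite rE.
have := row_form_le m u r0_ge0; have := shift_form_le m r0_ge0.
rewrite r1 !mulr1 -/c /u subn0 => shift row.
have uE : \sum_(j < m) normc p`_(m - j.+1) ^+ 2 = \sum_(j < m) normc p`_j ^+ 2.
  by rewrite [RHS](reindex_inj rev_ord_inj).
rewrite uE in row.
rewrite /inner big_ord_recl; apply: (le_trans (le_normcD _ _)).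
rewrite companion_mulmx_row0 normcM normcN normc_conjc rE.
have le_row : normc (\sum_(j < m.+1) p`_(rev_ord j) * x j 0) * r 0 <=
    (\sum_(j < m.+1) normc p`_(m - j) * r j) * r 0.
  apply: ler_wpM2r => //; apply: (le_trans (normc_sum _ _)).
  by apply: ler_sum => j _; rewrite normcM rE /= subSS.
have le_shift : normc (\sum_(i < m)
    (frobenius_companion m.+1 p *m x) (lift ord0 i) 0 *
    conjc (x (lift ord0 i) 0)) <= \sum_(i < m) r i * r i.+1.
  apply: (le_trans (normc_sum _ _)); apply: ler_sum => i _.
  by rewrite companion_mulmx_rowS normcM normc_conjc !rE /= /bump /= add1n.
have := lerD (le_trans le_row row) (le_trans le_shift shift).
by move=> /le_trans; apply; lra.
Qed.

(* The source prints [alpha], not [alpha ^+ 2], under the square root; that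
   version fails already for the polynomial X^2 - 100 and its zero 10. *)
Theorem theorem3p13 (R : realType) (n : nat) (hn : (0 < n)%N)
    (p : {poly R[i]}) (hmonic : p \is monic) (hdeg : size p = n.+1)
    (lambda : R[i]) (hroot : root p lambda) :
  let a (r : nat) : R[i] := p`_r in
  let alpha : R := Num.sqrt (\sum_(r < n.-1) normc (a r) ^+ 2) in
  let c : R := cos (pi / n%:R) in
  normc lambda <= numerical_radius (frobenius_companion n p) /\
  numerical_radius (frobenius_companion n p) <=
    2^-1 * (normc (a n.-1) + c
            + Num.sqrt (normc (a n.-1) ^+ 2 + alpha ^+ 2)
            + Num.sqrt (c ^+ 2 + 1)).
Proof.
case: n hn hdeg => // m _ hdeg a alpha c /=.
rewrite /alpha sqr_sqrtr; last by apply: sumr_ge0 => r _; exact: sqr_ge0.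
have ub := @companion_form_le R m p; split.
- have Cv := companion_eigenvector hmonic hdeg hroot.
  apply: (eigenvalue_le_numerical_radius _ Cv).
    apply/eqP => /colP /(_ ord_max); rewrite !mxE /= subnn expr0.
    by move/eqP; rewrite oner_eq0.
  by eexists => _ [x x1 <-]; exact: ub.
- apply: ge_sup; last by move=> _ [x x1 <-]; exact: ub.
  apply: image_nonempty; exists (delta_mx ord0 0) => /=.
  rewrite l2normE (bigD1 ord0) //= mxE !eqxx normc1 expr1n big1 ?addr0 ?sqrtr1 //.
  by move=> j j0; rewrite mxE (negPf j0) andFb mulr0n normc0 expr0n.
Qed.
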